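(* (Rogers formula.) Let $q\in\mathbb{C}$ with $q\neq1$ be such that $[n]_q\neq 0$ for all $n\geq 1$, let $u,\alpha\in\mathbb{C}$, let $(a_n^{(\alpha)})_{n\ge0}$ be complex numbers with $a_0^{(\alpha)}\neq0$ and $\mathcal{A}_q^{\alpha}(t)=\sum_{n\ge0}a_n^{(\alpha)}\frac{t^n}{[n]_q!}$, let $\mathrm{P}_{n,q}^{(\alpha)}(x;u)$ be defined by $\mathcal{A}_q^{\alpha}(t)\mathrm{e}_q(tx,u)=\sum_{n}\mathrm{P}_{n,q}^{(\alpha)}(x;u)\frac{t^n}{[n]_q!}$, and let $\mathrm{Q}_{n,q}^{(\alpha)}(x,y,z;u)=\sum_{k=0}^{n}\genfrac{[}{]}{0pt}{}{n}{k}_{q}\mathrm{P}_{k,q}^{(\alpha)}(x;u)y^kz^{n-k}$. Then, as formal power series in $t,s$, $$\sum_{n=0}^{\infty}\sum_{m=0}^{\infty}\mathrm{Q}_{n+m,q}^{(\alpha)}(x,y,z;u)\frac{t^n}{[n]_q!}\frac{s^m}{[m]_q!}=\mathrm{e}_q(zt)\mathrm{e}_q(zs)\sum_{n=0}^{\infty}\frac{\mathrm{P}_{n,q}^{(\alpha)}(x;u)y^n}{[n]_q!}\sum_{k=0}^{n}\genfrac{[}{]}{0pt}{}{n}{k}_{q}t^ks^{n-k}((1-q)zs;q)_k.$$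
   Context: $[n]_q=\frac{1-q^n}{1-q}$, $[n]_q!=[1]_q\cdots[n]_q$ ($[0]_q!=1$), $\genfrac{[}{]}{0pt}{}{n}{k}_{q}=\frac{[n]_q!}{[k]_q![n-k]_q!}$. $\mathrm{e}_q(z,u)=\sum_{n\ge0}u^{\binom{n}{2}}\frac{z^n}{[n]_q!}$ (convention $0^0=1$), $\mathrm{e}_q(z)=\mathrm{e}_q(z,1)$. $(a;q)_0=1$, $(a;q)_k=\prod_{j=0}^{k-1}(1-q^ja)$. *)

(* Defs.v *)
From HB Require Import structures.
From mathcomp Require Import all_boot all_order all_algebra.
From mathcomp Require Import boolp reals complex.
Set Implicit Arguments. Unset Strict Implicit. Unset Printing Implicit Defensive.
Import GRing.Theory.
Local Open Scope ring_scope.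

(* Formal power series in one indeterminate.  They form a commutative ring,
   so the construction is iterated to get two indeterminates. *)
Record fps (A : Type) := Fps { fps_coef :> nat -> A }.

Lemma fpsP (A : Type) (f g : fps A) : (forall n, f n = g n) -> f = g.
Proof. by case: f g => [f] [g] /= fg; congr Fps; apply/funext. Qed.

HB.instance Definition _ (A : Type) := gen_eqMixin (fps A).
HB.instance Definition _ (A : Type) := gen_choiceMixin (fps A).

Section FpsRing.
Variable A : comNzRingType.
Implicit Types f g h : fps A.

Definition fpsC (c : A) : fps A := Fps (fun n => if n is 0%N then c else 0).
Definition fpsX : fps A := Fps (fun n => (n == 1%N)%:R).

Definition fps_add f g := Fps (fun n => f n + g n).
Definition fps_opp f := Fps (fun n => - f n).
Definition fps_mul f g := Fps (fun n => \sum_(i < n.+1) f i * g (n - i)%N).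

Lemma fps_addA : associative fps_add.
Proof. by move=> f g h; apply: fpsP => n /=; rewrite addrA. Qed.
Lemma fps_addC : commutative fps_add.
Proof. by move=> f g; apply: fpsP => n /=; rewrite addrC. Qed.
Lemma fps_add0 : left_id (fpsC 0) fps_add.
Proof. by move=> f; apply: fpsP => -[|n] /=; rewrite add0r. Qed.
Lemma fps_addN : left_inverse (fpsC 0) fps_opp fps_add.
Proof. by move=> f; apply: fpsP => -[|n] /=; rewrite addNr. Qed.

HB.instance Definition _ :=
  GRing.isZmodule.Build (fps A) fps_addA fps_addC fps_add0 fps_addN.

Definition fps_trunc N f : {poly A} := \poly_(i < N) f i.

Lemma fps_mul_trunc N f g n : (n < N)%N ->
  fps_mul f g n = (fps_trunc N f * fps_trunc N g)`_n.
Proof.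
move=> nN; rewrite coefM /=; apply: eq_bigr => i _.
by rewrite !coef_poly !(leq_ltn_trans _ nN) ?leq_subr // -ltnS.
Qed.

Lemma fps_mulC : commutative fps_mul.
Proof. by move=> f g; apply: fpsP => n; rewrite !(@fps_mul_trunc n.+1) // mulrC. Qed.

Lemma fps_mulA : associative fps_mul.
Proof.
have truncl N f g h n : (n < N)%N -> fps_mul (fps_mul f g) h n =
    (fps_trunc N f * fps_trunc N g * fps_trunc N h)`_n.
  move=> nN; rewrite (fps_mul_trunc _ _ nN) !coefM; apply: eq_bigr => i _.
  have iN : (i < N)%N by apply: leq_ltn_trans nN; rewrite -ltnS.
  by congr (_ * _); rewrite coef_poly iN (fps_mul_trunc _ _ iN).
move=> f g h; apply: fpsP => n.
by rewrite fps_mulC !(truncl n.+1) // mulrC mulrA.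
Qed.

Lemma fps_mul1 : left_id (fpsC 1) fps_mul.
Proof.
move=> f; apply: fpsP => n /=.
by rewrite big_ord_recl mul1r subn0 big1 ?addr0 // => i _; rewrite mul0r.
Qed.

Lemma fps_mulDl : left_distributive fps_mul fps_add.
Proof.
move=> f g h; apply: fpsP => n /=; rewrite -big_split /=.
by apply: eq_bigr => i _; rewrite mulrDl.
Qed.

Lemma fps_one_neq0 : fpsC 1 != 0.
Proof.
by apply/eqP => /(congr1 (fun f : fps A => f 0%N)) /= /eqP; rewrite oner_eq0.
Qed.

HB.instance Definition _ := GRing.Zmodule_isComNzRing.Build (fps A)
  fps_mulA fps_mulC fps_mul1 fps_mulDl fps_one_neq0.

End FpsRing.

(* K[[s]][[t]]: for F : fps2 K, the coefficient of t^n s^m is F n m. *)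
Notation fps2 K := (fps (fps K)).

Section Fps2.
Variable K : comNzRingType.

Definition fps2C (c : K) : fps2 K := fpsC (fpsC c).
Definition fps2_t : fps2 K := fpsX (fps K).
Definition fps2_s : fps2 K := fpsC (fpsX K).

(* f(t) and f(s) for a univariate series f *)
Definition fps_in_t (f : fps K) : fps2 K := Fps (fun n => fpsC (f n)).
Definition fps_in_s (f : fps K) : fps2 K := fpsC f.

(* S is the sum of the family (F n): every coefficient of the partial sums is
   eventually constant, equal to that of S. *)
Definition fps2_sum_to (F : nat -> fps2 K) (S : fps2 K) : Prop :=
  forall i j : nat, exists N0 : nat, forall N : nat, (N0 <= N)%N ->
    (\sum_(n < N) F n) i j = S i j.

Lemma fps2_sum_to_unique F S S' :
  fps2_sum_to F S -> fps2_sum_to F S' -> S = S'.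
Proof.
move=> FS FS'; apply: fpsP => i; apply: fpsP => j.
have [N hN] := FS i j; have [N' hN'] := FS' i j.
by rewrite -(hN (maxn N N')) ?leq_maxl // hN' ?leq_maxr.
Qed.

End Fps2.

Section QCalculus.
Variables (K : fieldType) (q : K).

Definition qnum (n : nat) : K := (1 - q ^+ n) / (1 - q).
Definition qfact (n : nat) : K := \prod_(1 <= i < n.+1) qnum i.
(* only meaningful for k <= n *)
Definition qbinom (n k : nat) : K := qfact n / (qfact k * qfact (n - k)).

(* sum_n c_n T^n / [n]_q! *)
Definition qgen (c : nat -> K) : fps K := Fps (fun n => c n / qfact n).

(* e_q(c T, u) as a series in T; note 0 ^+ 0 = 1 *)
Definition qexp (c u : K) : fps K := qgen (fun n => u ^+ 'C(n, 2) * c ^+ n).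

(* sum_(n, m) c_(n, m) t^n / [n]_q! s^m / [m]_q! *)
Definition qgen2 (c : nat -> nat -> K) : fps2 K :=
  Fps (fun n => Fps (fun m => c n m / (qfact n * qfact m))).

(* Q_(n,q)(x, y, z; u), where p k stands for P_(k,q)(x; u) *)
Definition qQ (p : nat -> K) (n : nat) (y z : K) : K :=
  \sum_(k < n.+1) qbinom n k * p k * y ^+ k * z ^+ (n - k).

End QCalculus.

(* (a; q)_k *)
Definition qpoch (A : comNzRingType) (a q : A) (k : nat) : A :=
  \prod_(j < k) (1 - q ^+ j * a).

(* Main.v *)
(** Both sides are linear in the coefficients P_N(x) y^N, so it suffices to
    compare the coefficients of t^i s^j in front of each of them.  From
    e_q(w) (1 - (1 - q) w) = e_q(q w) one gets
    e_q(zs) ((1 - q) zs; q)_k = e_q(q^k zs), so that the N-th summand of the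
    right-hand side is e_q(zt) sum_k [N, k] t^k s^(N-k) e_q(q^k zs); comparing
    coefficients leaves exactly the q-Vandermonde identity
    [i + j, N] = sum_k [i, k] [j, N - k] q^(k (j - N + k)). *)
Require Import Defs.
From HB Require Import structures.
From mathcomp Require Import all_boot all_order all_algebra.
From mathcomp Require Import reals complex.
From mathcomp Require Import ring zify.
Import GRing.Theory.
Local Open Scope ring_scope.

Section FpsCoef.
Variable A : comNzRingType.
Implicit Types (f g : fps A) (c : A).

Lemma coef_fpsM f g n : (f * g) n = \sum_(i < n.+1) f i * g (n - i)%N.
Proof. by []. Qed.

Lemma coef_fps_sum (I : Type) (r : seq I) (Q : pred I) (F : I -> fps A) n :
  (\sum_(i <- r | Q i) F i) n = \sum_(i <- r | Q i) F i n.
Proof.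
by apply: (big_morph (fun f : fps A => f n)) => //; case: n.
Qed.

Lemma coef_fpsCM c f n : (fpsC c * f) n = c * f n.
Proof.
by rewrite coef_fpsM big_ord_recl subn0 big1 ?addr0 // => i _; rewrite mul0r.
Qed.

Lemma fpsC_zmod_morphism : zmod_morphism (@fpsC A).
Proof. by move=> c d; apply: fpsP => -[|n] //=; rewrite oppr0 addr0. Qed.

Lemma fpsC_monoid_morphism : monoid_morphism (@fpsC A).
Proof.
by split=> // c d; apply: fpsP => n; rewrite coef_fpsCM; case: n => //= n; rewrite mulr0.
Qed.

HB.instance Definition _ :=
  GRing.isZmodMorphism.Build A (fps A) (@fpsC A) fpsC_zmod_morphism.
HB.instance Definition _ :=
  GRing.isMonoidMorphism.Build A (fps A) (@fpsC A) fpsC_monoid_morphism.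

Lemma coef_fpsXM f n : (fpsX A * f) n = if n is m.+1 then f m else 0.
Proof.
rewrite coef_fpsM big_ord_recl mul0r add0r; case: n => [|n]; first by rewrite big_ord0.
rewrite big_ord_recl mul1r big1 ?addr0 ?subSS ?subn0 // => i _.
by rewrite mul0r.
Qed.

Lemma coef_fpsXnM k f n : (fpsX A ^+ k * f) n = if (k <= n)%N then f (n - k)%N else 0.
Proof.
elim: k n => [|k IHk] n; first by rewrite mul1r subn0.
by rewrite exprS -mulrA coef_fpsXM; case: n => // n; rewrite IHk.
Qed.

End FpsCoef.

Section Fps2Coef.
Variable K : comNzRingType.
Implicit Types (F G : fps2 K) (f g : fps K).

Lemma coef_fps2CM c F i j : (fps2C c * F) i j = c * F i j.
Proof. by rewrite coef_fpsCM coef_fpsCM. Qed.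

Lemma coef_fps2_tXnM k F i j :
  (fps2_t K ^+ k * F) i j = if (k <= i)%N then F (i - k)%N j else 0.
(* The zero of [fps K] is [fpsC 0], whose coefficient at [j] computes only once [j] is split. *)
Proof. by rewrite coef_fpsXnM; case: ifP => //; case: j. Qed.

Lemma coef_fps2_sXnM k F i j :
  (fps2_s K ^+ k * F) i j = if (k <= j)%N then F i (j - k)%N else 0.
Proof. by rewrite -rmorphXn coef_fpsCM coef_fpsXnM. Qed.

Lemma coef_fps_in_tsM f g i j : (fps_in_t f * fps_in_s g) i j = f i * g j.
Proof. by rewrite mulrC coef_fpsCM mulrC coef_fpsCM. Qed.

Lemma coef_fps2_sum (I : Type) (r : seq I) (Q : pred I) (F : I -> fps2 K) i j :
  (\sum_(n <- r | Q n) F n) i j = \sum_(n <- r | Q n) F n i j.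
Proof. by rewrite coef_fps_sum coef_fps_sum. Qed.

(** A Cauchy product never reads a coefficient beyond the requested index; this lets a finite
    partial sum stand in for an infinite one. *)
Lemma eq_coef_fps2M E F G i j :
  (forall i' j', (i' <= i)%N -> (j' <= j)%N -> F i' j' = G i' j') ->
  (E * F) i j = (E * G) i j.
Proof.
move=> FG; rewrite !coef_fpsM !coef_fps_sum; apply: eq_bigr => k _.
by rewrite !coef_fpsM; apply: eq_bigr => l _; rewrite FG ?leq_subr.
Qed.

End Fps2Coef.

Lemma rmorph_qpoch (A B : comNzRingType) (f : {rmorphism A -> B}) (a q : A) k :
  f (qpoch a q k) = qpoch (f a) (f q) k.
Proof.
rewrite /qpoch rmorph_prod; apply: eq_bigr => j _.
by rewrite rmorphB rmorph1 rmorphM rmorphXn.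
Qed.

Section QIdentities.
Variables (K : fieldType) (q : K).
Hypothesis q_neq1 : q != 1.
Hypothesis qnum_neq0 : forall n, (1 <= n)%N -> qnum q n != 0.

Lemma qfact0 : qfact q 0 = 1. Proof. by rewrite /qfact big_geq. Qed.

Lemma qfactS n : qfact q n.+1 = qfact q n * qnum q n.+1.
Proof. by rewrite /qfact big_nat_recr. Qed.

Lemma qfact_neq0 n : qfact q n != 0.
Proof.
by elim: n => [|n IHn]; rewrite ?qfact0 ?oner_neq0 // qfactS mulf_neq0 ?qnum_neq0.
Qed.

Lemma subr1q_neq0 : 1 - q != 0. Proof. by rewrite subr_eq0 eq_sym. Qed.

Lemma qnumD m n : qnum q (m + n) = qnum q m + q ^+ m * qnum q n.
Proof. by rewrite /qnum exprD; field; rewrite subr1q_neq0. Qed.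

(* Unlike [qbinom], vanishes for [n < k]. *)
Definition qbin n k := if (k <= n)%N then qbinom q n k else 0.

Lemma qbin0 n : qbin n 0 = 1.
Proof. by rewrite /qbin /qbinom qfact0 mul1r subn0 divff ?qfact_neq0. Qed.

Lemma qbin_small n k : (n < k)%N -> qbin n k = 0.
Proof. by rewrite /qbin ltnNge => /negbTE->. Qed.

(** This q-Pascal rule comes from [n+1] = [n-k] + q^(n-k) [k+1] when k < n; for k >= n both sides
    are 0 or 1. *)
Lemma qbinS n k : qbin n.+1 k.+1 = qbin n k.+1 + q ^+ (n - k) * qbin n k.
Proof.
have [nk|kn|->] := ltngtP n k.
- by rewrite !qbin_small ?mulr0 ?addr0 // ltnW.
- have [m ->] : exists m, n = (k + m.+1)%N by exists (n - k.+1)%N; lia.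
  rewrite /qbin !ifT; try lia.
  rewrite /qbinom !subSS addKn (_ : _ - k.+1 = m)%N; last lia.
  rewrite !qfactS -addSn (addnC k.+1) qnumD.
  have := qfact_neq0 m; have := qfact_neq0 k.
  have /qnum_neq0 := ltn0Sn m; have /qnum_neq0 := ltn0Sn k.
  by move=> h1 h2 h3 h4; field; rewrite h1 h2 h3 h4.
- rewrite (qbin_small k k.+1) // subnn mul1r add0r /qbin !leqnn /qbinom !subnn qfact0.
  by rewrite !mulr1 !divff ?qfact_neq0.
Qed.

(** Induction on [n]: applying q-Pascal to the left side and to each [qbin n.+1 k.+1] on the right
    matches the terms one by one. *)
Lemma q_vandermonde n m N :
  qbin (n + m) N = \sum_(k < N.+1) qbin n k * qbin m (N - k) * q ^+ (k * (m - (N - k))).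
Proof.
elim: n N => [|n IHn] N.
  rewrite add0n big_ord_recl big1 ?addr0 => [|i _].
    by rewrite qbin0 mul1r subn0 mul0n mulr1.
  by rewrite qbin_small ?mul0r.
case: N => [|N]; first by rewrite big_ord1 !qbin0 !mul1r.
rewrite addSn qbinS !IHn big_ord_recl [in RHS]big_ord_recl !qbin0 -addrA.
congr (_ + _); rewrite mulr_sumr -big_split /=; apply: eq_bigr => k _.
rewrite /bump /= !add1n !subSS qbinS !mulrDl; congr (_ + _).
(* Subtraction is truncated: the exponents of q agree when k <= n and N - k <= m, and outside this
   range a vanishing q-binomial kills both sides. *)
have [nk|kn] := ltnP n k; first by rewrite qbin_small // !(mulr0, mul0r).
have [mk|km] := ltnP m (N - k).
  by rewrite (qbin_small m) // !(mulr0, mul0r).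
have -> : (n + m - N = n - k + (m - (N - k)))%N by have := ltn_ord k; lia.
by rewrite mulSn !exprD; ring.
Qed.

(** In degree n+1 this is 1 - (1 - q) [n+1] = q^(n+1), up to the factor w^(n+1) / [n+1]!. *)
Lemma qexp_mulq w :
  qexp q w 1 * (1 - fpsC ((1 - q) * w) * fpsX K) = qexp q (q * w) 1.
Proof.
apply: fpsP => n; rewrite mulrBr mulr1 mulrC -mulrA.
rewrite -[LHS]/(_ n - _ n) coef_fpsCM coef_fpsXM.
case: n => [|n] /=; rewrite !expr1n !mul1r ?mulr0 ?subr0 //.
rewrite qfactS exprMn [w ^+ n.+1]exprS.
have := qfact_neq0 n; have := qnum_neq0 n.+1 isT.
have -> : qnum q n.+1 = (1 - q ^+ n.+1) / (1 - q) by [].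
(* The nonvanishing of [n+1] is split into that of 1 - q^(n+1) and of 1 - q, the side conditions of
   [field]. *)
rewrite mulf_eq0 invr_eq0 negb_or => /andP[h1 h2] h3.
by field; rewrite h1 h2 h3.
Qed.

(** The product telescopes: its factor of index j replaces q^j w by q^(j+1) w in the exponential. *)
Lemma qexp_qpoch w k :
  qexp q w 1 * qpoch (fpsC ((1 - q) * w) * fpsX K) (fpsC q) k =
  qexp q (q ^+ k * w) 1.
Proof.
elim: k => [|k IHk]; first by rewrite /qpoch big_ord0 mulr1 mul1r.
rewrite /qpoch big_ord_recr /= mulrA [X in X * _]IHk exprS -mulrA -qexp_mulq.
congr (_ * (1 - _)); rewrite mulrA -rmorphXn -rmorphM.
by congr (fpsC _ * _); ring.
Qed.

Section Rogers.
Variables (p : nat -> K) (y z : K).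

Definition rogers_term n : fps2 K :=
  fps2C (p n * y ^+ n / qfact q n) *
    \sum_(k < n.+1) fps2C (qbinom q n k) * fps2_t K ^+ k * fps2_s K ^+ (n - k) *
       qpoch (fps2C ((1 - q) * z) * fps2_s K) (fps2C q) k.

(** Every summand carries the monomial t^k s^(n-k), so only total degrees at least n occur. *)
Lemma rogers_term_small n i j : (i + j < n)%N -> rogers_term n i j = 0.
Proof.
move=> ijn; rewrite coef_fps2CM coef_fps2_sum big1 ?mulr0 // => k _.
rewrite -!mulrA coef_fps2CM coef_fps2_tXnM.
case: ifP => ki; last by rewrite mulr0.
rewrite coef_fps2_sXnM; case: ifP => kj; first by lia.
by rewrite mulr0.
Qed.

Lemma rogers_term_sum_stable N i j : (i + j < N)%N ->
  (\sum_(n < N) rogers_term n) i j = \sum_(n < (i + j).+1) rogers_term n i j.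
Proof.
move=> ijN; rewrite coef_fps2_sum (big_ord_widen _ (fun n => rogers_term n i j) ijN).
rewrite [RHS]big_mkcond; apply: eq_bigr => n _.
by case: ifP => // /negbT; rewrite -leqNgt => /rogers_term_small.
Qed.

Definition rogers_sum : fps2 K :=
  Fps (fun i => Fps (fun j => \sum_(n < (i + j).+1) rogers_term n i j)).

Lemma rogers_sumP : fps2_sum_to rogers_term rogers_sum.
Proof.
by move=> i j; exists (i + j).+1 => N; apply: rogers_term_sum_stable.
Qed.

Lemma coef_qexpM_rogers_term n i j : (n <= i + j)%N ->
  (fps_in_t (qexp q z 1) * fps_in_s (qexp q z 1) * rogers_term n) i j =
  qbinom q (i + j) n * p n * y ^+ n * z ^+ (i + j - n) / (qfact q i * qfact q j).
Proof.
move=> nij; rewrite mulrCA coef_fps2CM mulr_sumr coef_fps2_sum.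
have -> : qbinom q (i + j) n = qbin (i + j) n by rewrite /qbin nij.
rewrite q_vandermonde !mulr_suml mulr_sumr; apply: eq_bigr => k _.
have kn : (k <= n)%N by rewrite -ltnS.
(* The q-Pochhammer symbol involves s alone, so it is pulled back along [fpsC] to K[[s]], where
   [qexp_qpoch] applies. *)
have -> : qpoch (fps2C ((1 - q) * z) * fps2_s K) (fps2C q) k =
    fps_in_s (qpoch (fpsC ((1 - q) * z) * fpsX K) (fpsC q) k).
  by rewrite /fps_in_s rmorph_qpoch rmorphM.
have regroup (b c d e f g : fps2 K) :
    b * c * (d * e * f * g) = d * (e * (f * (b * (c * g)))) by ring.
rewrite regroup {regroup} -rmorphM qexp_qpoch coef_fps2CM coef_fps2_tXnM.
(* If k > i or n - k > j, then t^k s^(n-k) does not divide t^i s^j, and the matching Vandermonde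
   term is zero too. *)
have [ki|ik] := leqP k i; last by rewrite qbin_small // !(mulr0, mul0r).
rewrite coef_fps2_sXnM.
have [kj|jk] := leqP (n - k)%N j; last by rewrite (qbin_small j) // !(mulr0, mul0r).
(* Expanding (q^k z)^(j-(n-k)) produces the Vandermonde weight q^(k(j-(n-k))). *)
rewrite coef_fps_in_tsM /qbin ki kj /qbinom /= !expr1n !mul1r exprMn -exprM.
have -> : (i + j - n = i - k + (j - (n - k)))%N by lia.
rewrite exprD.
by field; rewrite !qfact_neq0.
Qed.

Lemma rogers_formula :
  qgen2 q (fun n m => qQ q p (n + m) y z) =
  fps_in_t (qexp q z 1) * fps_in_s (qexp q z 1) * rogers_sum.
Proof.
apply: fpsP => i; apply: fpsP => j.
(* The partial sum up to [i + j] has the same coefficients as [rogers_sum] at all indices below (i,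
   j), and it can be distributed over. *)
rewrite (eq_coef_fps2M _ _ _ (\sum_(n < (i + j).+1) rogers_term n)); last first.
  by move=> i' j' ii' jj'; rewrite rogers_term_sum_stable // ltnS leq_add.
rewrite mulr_sumr coef_fps2_sum /= /qQ mulr_suml; apply: eq_bigr => n _.
by rewrite coef_qexpM_rogers_term // -ltnS.
Qed.

End Rogers.

End QIdentities.

Theorem theorem17 (R : realType) (q u alpha : R[i])
    (a : R[i] -> nat -> R[i]) (P : nat -> R[i] -> R[i]) (x y z : R[i])
    (hq1 : q != 1)
    (hq : forall n : nat, (1 <= n)%N -> qnum q n != 0)
    (ha : a alpha 0%N != 0)
    (hP : forall w : R[i],
       qgen q (a alpha) * qexp q w u = qgen q (fun n => P n w)) :
  exists2 S : fps2 R[i],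
    fps2_sum_to
      (fun n => fps2C (P n x * y ^+ n / qfact q n) *
         \sum_(k < n.+1) fps2C (qbinom q n k) *
            fps2_t R[i] ^+ k * fps2_s R[i] ^+ (n - k) *
            qpoch (fps2C ((1 - q) * z) * fps2_s R[i]) (fps2C q) k)
      S
    & qgen2 q (fun n m => qQ q (P^~ x) (n + m) y z) =
      fps_in_t (qexp q z 1) * fps_in_s (qexp q z 1) * S.
Proof.
exists (rogers_sum _ q (P^~ x) y z); first exact: rogers_sumP.
exact: rogers_formula.
Qed.
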